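(* Let $q$ be a power of a prime. For any multiplicative characters $A,A',B,B',C$ of $\mathbb{F}_q^*$ and any $x,y\in\mathbb{F}_q$, \begin{align*} F_{3}(A,A';B,B';C;x,y)&=\frac{1}{(q-1)^2}\sum_{\chi,\lambda}\binom{\overline{A}}{\chi}\binom{\overline{A'}}{\lambda}\binom{C\overline{B}\,\overline{B'}}{C\overline{B'}\chi}\binom{C\overline{B'}\chi}{C\chi\lambda}\chi(x)\lambda(y)\\ &\quad+\varepsilon(y)\,B'(-1)\binom{\overline{A}}{B'\overline{C}}B'\overline{C}(x)\,\overline{A'}(1-y), \end{align*} where $\chi$ and $\lambda$ each range over all multiplicative characters of $\mathbb{F}_q^*$.
   Context: $\mathbb{F}_q$ is the finite field with $q$ elements. Characters are complex-valued multiplicative characters of $\mathbb{F}_q^*$; every character $\chi$, including the trivial character $\varepsilon$, is extended to $\mathbb{F}_q$ by $\chi(0)=0$. $\overline{\chi}$ is the inverse of $\chi$; juxtaposition of characters is their product, so that e.g. $B'\overline{C}(x)$ means $(B'\overline{C})(x)$. For characters $\chi,\lambda$ the Jacobi sum is $J(\chi,\lambda)=\sum_{u\in\mathbb{F}_q}\chi(u)\lambda(1-u)$, and the binomial coefficient of characters $A,B$ is $\binom{A}{B}=B(-1)J(A,\overline{B})$ (no factor $1/q$). The finite field Appell series $F_3$ is $$F_{3}(A,A';B,B';C;x,y)=\varepsilon(xy)\,BB'(-1)\sum_{u,v\in\mathbb{F}_q}B(u)\,B'(v)\,C\overline{B}\,\overline{B'}(1-u-v)\,\overline{A}(1-ux)\,\overline{A'}(1-vy).$$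 *)

(* Defs.v *)
From HB Require Import structures.
From mathcomp Require Import all_boot all_order all_fingroup all_algebra.
From mathcomp Require Import all_solvable all_field all_character.

Set Implicit Arguments.
Unset Strict Implicit.
Unset Printing Implicit Defensive.

Import Order.TTheory GRing.Theory Num.Theory.
Local Open Scope ring_scope.

(* A multiplicative character of the finite field F is a linear character of
   the group {unit F}.  Its values are roots of unity, so algC is large enough
   to carry every complex-valued character.  In the ring of class functions,
   1 is the trivial character and, on linear characters, product and inverse
   are the pointwise ones. *)
Notation mclass F := 'CF([set: {unit F}]).

Definition mchars (F : finFieldType) : seq (mclass F) :=
  [seq chi <- irr [set: {unit F}] | chi \is a linear_char].

Lemma mem_mchars (F : finFieldType) (chi : mclass F) :
  (chi \in mchars F) = (chi \is a linear_char).
Proof.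
rewrite mem_filter; case: (boolP (chi \is a linear_char)) => //= lin_chi.
exact: lin_char_irr.
Qed.

Lemma mchars_uniq (F : finFieldType) : uniq (mchars F).
Proof. by rewrite filter_uniq ?free_uniq ?irr_free. Qed.

(* The trivial character is also extended by 0 at 0. *)
Definition mval (F : finFieldType) (chi : mclass F) (x : F) : algC :=
  if insub x is Some u then chi (u : {unit F}) else 0.

Lemma mval0 (F : finFieldType) (chi : mclass F) : mval chi 0 = 0.
Proof. by rewrite /mval insubF // unitr0. Qed.

Lemma mval_unit (F : finFieldType) (chi : mclass F) (u : {unit F}) :
  mval chi (val u) = chi u.
Proof. by rewrite /mval valK. Qed.

Definition jacobi_sum (F : finFieldType) (chi lam : mclass F) : algC :=
  \sum_(u : F) mval chi u * mval lam (1 - u).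

(* Normalised without the factor 1 / q. *)
Definition mbinom (F : finFieldType) (A B : mclass F) : algC :=
  mval B (- 1) * jacobi_sum A B^-1.

Definition appellF3 (F : finFieldType) (A A' B B' C : mclass F) (x y : F) :
    algC :=
  mval 1 (x * y) * mval (B * B') (- 1) *
  \sum_(u : F) \sum_(v : F)
    mval B u * mval B' v * mval (C * B^-1 * B'^-1) (1 - u - v) *
    mval A^-1 (1 - u * x) * mval A'^-1 (1 - v * y).

(* Main.v *)
Require Import Defs.
From HB Require Import structures.
From mathcomp Require Import all_boot all_order all_fingroup all_algebra.
From mathcomp Require Import all_solvable all_field all_character.
From mathcomp Require Import ring.

Set Implicit Arguments.
Unset Strict Implicit.
Unset Printing Implicit Defensive.

Import Order.TTheory GRing.Theory Num.Theory.
Local Open Scope ring_scope.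

(** Write [eps] for the trivial character and [q] for [#|F|].  The factors
    [A^-1(1 - u x)] and [A'^-1(1 - v y)] of the Appell sum are expanded by the
    binomial theorem over finite fields ([mbinom_theorem]),
      [(q - 1) eps(z) A(1 + z) = \sum_chi (A choose chi) chi(z)],
    which expresses the orthogonality of characters.  After exchanging sums
    ([appellF3_expansion]), the coefficient of [chi(x) lam(y)] is a product of
    two binomials times a double sum of Selberg type
      [\sum_(u, v) (B chi)(u) (B' lam)(v) D(1 - u - v)]
    with [D = C / (B B')].  Summing over [u] at fixed [v] and rescaling by
    [1 - v] evaluates it as a product of two Jacobi sums, except that at
    [v = 1] the rescaling is impossible: there the inner sum is, up to the
    sign [D(-1)], the complete sum of the character [D B chi], which is
    [q - 1] when that character is trivial and [0] otherwise
    ([double_jacobi_sum]).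

    The reflection formula for Jacobi sums ([jacobi_sum_reflect]) turns each
    Jacobi sum into a binomial ([mbinom_jacobi]), which gives the double
    series.  The contribution of [v = 1] only survives at [chi = B' / C]; the
    remaining sum over [lam] is then resummed by the binomial theorem, and
    gives the additional term of the identity.  The evaluation of the double
    sum holds for every choice of characters, trivial ones included, so no
    degenerate case has to be separated. *)

(** * Characters extended by zero *)

Section ExtendedCharacters.

Variable F : finFieldType.
Implicit Types (A B D chi lam : mclass F) (s x y z : F).

Local Notation q1 := (#|F|%:R - 1 : algC).

Lemma unit_of_neq0 x : x != 0 -> exists u : {unit F}, x = val u.
Proof.
rewrite -unitfE => Ux.
by exists (Sub x Ux); rewrite SubK.
Qed.

Lemma mvalM chi x y :
  chi \is a linear_char -> mval chi (x * y) = mval chi x * mval chi y.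
Proof.
move=> chi_lin.
have [->|/unit_of_neq0[u ->]] := eqVneq x 0; first by rewrite mul0r mval0 mul0r.
have [->|/unit_of_neq0[v ->]] := eqVneq y 0.
  by rewrite mulr0 mval0 mulr0.
by rewrite -FinRing.val_unitM !mval_unit lin_charM ?inE.
Qed.

Lemma mval_mul chi lam x : mval (chi * lam) x = mval chi x * mval lam x.
Proof.
have [->|/unit_of_neq0[u ->]] := eqVneq x 0; first by rewrite !mval0 mul0r.
by rewrite !mval_unit cfunE.
Qed.

Lemma mval_triv x : mval 1 x = (x != 0)%:R.
Proof.
have [->|nz_x] := eqVneq x 0; first by rewrite mval0.
by have [u ->] := unit_of_neq0 nz_x; rewrite mval_unit cfun1E inE.
Qed.

Lemma mval1 chi : chi \is a linear_char -> mval chi 1 = 1.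
Proof. by move=> chi_lin; rewrite (mval_unit chi 1%g) lin_char1. Qed.

Lemma mval_inv chi x :
  chi \is a linear_char -> mval chi^-1 x = (mval chi x)^-1.
Proof.
move=> chi_lin.
have [->|/unit_of_neq0[u ->]] := eqVneq x 0; first by rewrite !mval0 invr0.
rewrite !mval_unit -lin_charV ?inE // invr_lin_char // cfunE.
by rewrite lin_charV_conj ?inE.
Qed.

Lemma mvalV chi x :
  chi \is a linear_char -> mval chi x^-1 = mval chi^-1 x.
Proof.
move=> chi_lin; rewrite mval_inv //.
have [->|nz_x] := eqVneq x 0; first by rewrite invr0 mval0 invr0.
have chi_xV : mval chi x^-1 * mval chi x = 1.
  by rewrite -mvalM // mulVf // mval1.
have nz_chi : mval chi x != 0.
  by apply/eqP=> chi0; move/eqP: chi_xV; rewrite chi0 mulr0 eq_sym oner_eq0.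
by rewrite -[LHS](mulfK nz_chi) chi_xV mul1r.
Qed.

Lemma mvalN1_sqr chi :
  chi \is a linear_char -> mval chi (- 1) * mval chi (- 1) = 1.
Proof. by move=> chi_lin; rewrite -mvalM // mulrNN mulr1 mval1. Qed.

Lemma mvalN1V chi :
  chi \is a linear_char -> (mval chi (- 1))^-1 = mval chi (- 1).
Proof. by move=> chi_lin; rewrite -mval_inv // -mvalV // invrN1. Qed.

Lemma mvalN chi x :
  chi \is a linear_char -> mval chi (- x) = mval chi (- 1) * mval chi x.
Proof. by move=> chi_lin; rewrite -mvalM // mulN1r. Qed.

Lemma mul_mchar_eq1 chi lam :
  lam \is a linear_char -> (chi * lam == 1) = (chi == lam^-1).
Proof.
move=> lam_lin; have lamU := lin_char_unitr lam_lin.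
by rewrite -[RHS](inj_eq (mulIr lamU)) mulVr.
Qed.

(** * Orthogonality *)

Lemma card_units : #|[set: {unit F}]|%:R = q1.
Proof.
rewrite card_finField_unit.
by rewrite -[in RHS](prednK (ltnW (card_finNzRing_gt1 F))) -natr1 addrK.
Qed.

Lemma sum_mval chi :
  chi \is a linear_char -> \sum_x mval chi x = q1 *+ (chi == 1).
Proof.
move=> chi_lin; have [->|nt_chi] := eqVneq chi 1.
  rewrite (bigD1 0) //= mval0 add0r.
  rewrite (eq_bigr (fun=> 1)) => [|x nz_x]; last by rewrite mval_triv nz_x.
  by rewrite sumr_const (cardC1 (0 : F)) -card_finField_unit card_units.
have [u nt_u]: exists u, chi u != 1.
  apply/existsP; apply: contraR nt_chi; rewrite negb_exists => /forallP chi1; apply/eqP/cfunP=> u.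
  by rewrite cfun1E inE; apply/eqP; have:= chi1 u; rewrite negbK.
(* The substitution [x := u * x] multiplies the sum by [chi u != 1]. *)
have nz_u : val u != 0 by rewrite -unitfE (valP u).
apply/eqP; have: \sum_x mval chi x = chi u * \sum_x mval chi x.
  rewrite {1}(reindex_inj (mulfI nz_u)) mulr_sumr.
  by apply: eq_bigr => x _; rewrite mvalM // mval_unit.
move/eqP; rewrite -subr_eq0 -{1}[\sum_x _]mul1r -mulrBl mulf_eq0 subr_eq0.
by rewrite eq_sym (negPf nt_u).
Qed.

Lemma sum_mchars z : \sum_(chi <- mchars F) mval chi z = q1 *+ (z == 1).
Proof.
have abF : abelian [set: {unit F}].
  exact/cyclic_abelian/field_unit_group_cyclic.
have -> : mchars F = irr [set: {unit F}].
  apply/all_filterP/allP=> _ /irrP[i ->].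
  exact: (char_abelianP _ abF).
have [->|/unit_of_neq0[u ->]] := eqVneq z 0.
  by rewrite eq_sym oner_eq0 big1_seq // => chi _; rewrite mval0.
have := @second_orthogonality_relation _ [set: {unit F}] u 1%g (in_setT _).
rewrite class1G inE => orth.
rewrite big_tuple (eq_bigr (fun i => 'chi_i u * ('chi_i 1%g)^*)); last first.
  move=> i _; rewrite mval_unit lin_char1 ?conjC1 ?mulr1 //.
  exact: (char_abelianP _ abF).
have -> : (val u == 1) = (u == 1%g) by exact: (inj_eq val_inj u 1%g).
rewrite orth.
have [->|//] := eqVneq u 1%g.
by rewrite cent11T setIT card_units.
Qed.

(** Exchanging sums, the characters detect the single term of the Jacobi sum
    where [- z = 1 - u], that is [u = 1 + z]; the sign [chi(- 1)] in [mbinom]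
    makes the argument of [A] a sum.  The factor [mval 1 z] is there because
    the left-hand side vanishes at [z = 0], while [mval A 1] need not. *)
Lemma mbinom_theorem A z :
  \sum_(chi <- mchars F) mbinom A chi * mval chi z =
    q1 * mval 1 z * mval A (1 + z).
Proof.
have [->|nz_z] := eqVneq z 0.
  by rewrite mval0 mulr0 mul0r big1 // => chi _; rewrite mval0 mulr0.
rewrite mval_triv nz_z mulr1.
transitivity (\sum_(u : F) mval A u * (q1 *+ (u == 1 + z))); last first.
  rewrite (bigD1 (1 + z)) //= eqxx mulr1n mulrC big1 ?addr0 // => u /negPf->.
  by rewrite mulr0.
transitivity (\sum_(chi <- mchars F) \sum_(u : F)
                mval A u * mval chi (- z / (1 - u))).
  rewrite big_seq [RHS]big_seq; apply: eq_bigr => chi.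
  rewrite mem_mchars => chi_lin.
  rewrite /mbinom /jacobi_sum mulr_sumr mulr_suml; apply: eq_bigr => u _.
  rewrite mvalM // mvalN // mvalV //; ring.
rewrite exchange_big; apply: eq_bigr => u _.
rewrite -mulr_sumr sum_mchars.
have [->|nz_u] := eqVneq u 1.
  rewrite subrr invr0 mulr0 eq_sym oner_eq0.
  by rewrite -subr_eq0 opprD addNKr oppr_eq0 (negPf nz_z).
congr (_ * (_ *+ nat_of_bool _)).
rewrite -(inj_eq (mulIf (_ : 1 - u != 0))) ?subr_eq0 1?eq_sym //.
rewrite divfK ?mul1r ?subr_eq0 1?eq_sym //.
by rewrite -subr_eq0 -[RHS]subr_eq0; congr (_ == _); ring.
Qed.

(** * Jacobi sums *)

Lemma jacobi_sumC chi lam : jacobi_sum chi lam = jacobi_sum lam chi.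
Proof.
rewrite /jacobi_sum (reindex_inj (subrI 1)) /=.
by apply: eq_bigr => u _; rewrite subKr mulrC.
Qed.

(** The substitution [u := u / (u - 1)], an involution away from [u = 1],
    fixes [0] and swaps [1] with infinity, hence swaps the characters [lam] and
    [(chi * lam)^-1] (up to sign) attached to these two points. *)
Lemma jacobi_sum_reflect chi lam :
    chi \is a linear_char -> lam \is a linear_char ->
  jacobi_sum chi lam = mval chi (- 1) * jacobi_sum chi (chi * lam)^-1.
Proof.
move=> chi_lin lam_lin.
have lin_inv : (chi * lam)^-1 \is a linear_char by rewrite rpredV rpredM.
(* The value at [1] only makes [f] a bijection: both summands vanish there. *)
pose f (u : F) := if u == 1 then 1 else u / (u - 1).
have fK : involutive f.
  move=> u; rewrite /f; have [->|nu] := eqVneq u 1; first by rewrite eqxx.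
  have nz : u - 1 != 0 by rewrite subr_eq0.
  have fm1 : u / (u - 1) - 1 = (u - 1)^-1.
    by rewrite -{2}(mulfV nz) -mulrBl subKr mul1r.
  by rewrite -subr_eq0 fm1 invr_eq0 (negPf nz) invrK divfK.
rewrite /jacobi_sum (reindex_inj (inv_inj fK)) mulr_sumr.
apply: eq_bigr => u _; rewrite /f.
have [->|nu] := eqVneq u 1; first by rewrite subrr !mval0 !mulr0.
have nz : u - 1 != 0 by rewrite subr_eq0.
have -> : 1 - u / (u - 1) = - 1 / (u - 1).
  by rewrite -{1}(mulfV nz) -mulrBl; congr (_ / _); ring.
have -> : u - 1 = - 1 * (1 - u) by ring.
rewrite mval_inv ?rpredM // mval_mul.
rewrite !mvalM // !mvalV // !mval_inv // !mvalM // !invfM.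
rewrite !mvalN1V // [X in _ * X]mulrA mvalN1_sqr // mul1r; ring.
Qed.

(** With the lower entry written as [D * chi], the reflection formula absorbs
    the inverse in the definition of the binomial.  Both binomials of the
    double series have this shape. *)
Lemma mbinom_jacobi D chi :
    D \is a linear_char -> chi \is a linear_char ->
  mbinom D (D * chi) = mval chi (- 1) * jacobi_sum chi D.
Proof.
move=> D_lin chi_lin.
by rewrite jacobi_sumC jacobi_sum_reflect // /mbinom mval_mul; ring.
Qed.

(** Homogeneity gives the first summand; at [s = 0] the sum degenerates to a
    complete character sum. *)
Lemma sum_mval_shift chi lam s :
    chi \is a linear_char -> lam \is a linear_char ->
  \sum_u mval chi u * mval lam (s - u) =
    mval (chi * lam) s * jacobi_sum chi lam
    + mval lam (- 1) * (q1 *+ (chi * lam == 1)) *+ (s == 0).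
Proof.
move=> chi_lin lam_lin; have [->|nz_s] := eqVneq s 0.
  rewrite mval0 mul0r add0r mulr1n -sum_mval ?rpredM // mulr_sumr.
  by apply: eq_bigr => u _; rewrite sub0r mvalN // mval_mul mulrCA.
rewrite mulr0n addr0 /jacobi_sum mulr_sumr (reindex_inj (mulfI nz_s)).
apply: eq_bigr => u _.
have -> : s - s * u = s * (1 - u) by ring.
by rewrite !mvalM // mval_mul; ring.
Qed.

(** The sum over [u] is [sum_mval_shift] at [s = 1 - v], so the second summand
    is the contribution of [v = 1]. *)
Lemma double_jacobi_sum chi lam D :
    chi \is a linear_char -> lam \is a linear_char -> D \is a linear_char ->
  \sum_u \sum_v mval chi u * mval lam v * mval D (1 - u - v) =
    jacobi_sum chi D * jacobi_sum lam (D * chi)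
    + mval D (- 1) * (q1 *+ (D * chi == 1)).
Proof.
move=> chi_lin lam_lin D_lin; rewrite exchange_big /=.
transitivity (\sum_v (jacobi_sum chi D * (mval lam v * mval (D * chi) (1 - v))
    + mval lam v * (mval D (- 1) * (q1 *+ (D * chi == 1)) *+ (v == 1)))).
  apply: eq_bigr => v _.
  transitivity (mval lam v * \sum_u mval chi u * mval D (1 - v - u)).
    rewrite mulr_sumr; apply: eq_bigr => u _.
    by rewrite (addrAC 1) mulrCA mulrA.
  rewrite sum_mval_shift // subr_eq0 [1 == v]eq_sym [chi * D]mulrC; ring.
rewrite big_split -mulr_sumr; congr (_ + _).
rewrite (bigD1 1) //= eqxx mulr1n mval1 // mul1r big1 ?addr0 // => v /negPf->.
by rewrite mulr0.
Qed.

Lemma double_jacobi_sum_mbinom chi lam D :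
    chi \is a linear_char -> lam \is a linear_char -> D \is a linear_char ->
  mval (chi * lam) (- 1) *
      (\sum_u \sum_v mval chi u * mval lam v * mval D (1 - u - v)) =
    mbinom D (D * chi) * mbinom (D * chi) (D * chi * lam)
    + mval lam (- 1) * (q1 *+ (D * chi == 1)).
Proof.
move=> chi_lin lam_lin D_lin.
rewrite double_jacobi_sum // !mbinom_jacobi ?rpredM // mval_mul mulrDr.
congr (_ + _); first by ring.
(* If [D * chi = 1], the signs of [chi] and [D] at [- 1] cancel. *)
have [/eqP|] := eqVneq (D * chi) 1; last by rewrite !mulr0.
rewrite mul_mchar_eq1 // => /eqP->.
rewrite mval_inv // mvalN1V // -[RHS]mul1r -(mvalN1_sqr chi_lin); ring.
Qed.

(** * Expansion of the Appell sum *)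

(** The binomial expansion at [- (u * x)] carries the factor [eps(u) eps(x)];
    multiplying by [mval B u] makes [eps(u)] redundant, and [eps(x)] is the
    factor that the Appell sum contains. *)
Lemma mbinom_expansion A B u x :
  q1 * (mval 1 x * mval B u * mval A (1 - u * x)) =
  \sum_(chi <- mchars F)
     mbinom A chi * mval chi x * (mval chi (- 1) * mval (B * chi) u).
Proof.
have -> : mval 1 x * mval B u = mval B u * mval 1 (- (u * x)).
  rewrite -{1}[B]mulr1 mval_mul !mval_triv oppr_eq0 mulf_eq0 negb_or.
  by rewrite -mulnb natrM; ring.
transitivity (mval B u * (q1 * mval 1 (- (u * x)) * mval A (1 - u * x))).
  by ring.
rewrite -mbinom_theorem mulr_sumr big_seq [RHS]big_seq.
apply: eq_bigr => chi; rewrite mem_mchars => chi_lin.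
by rewrite mvalN // mvalM // mval_mul; ring.
Qed.

Lemma appellF3_expansion A A' B B' C x y :
  q1 ^+ 2 * appellF3 A A' B B' C x y =
  \sum_(chi <- mchars F) \sum_(lam <- mchars F)
    mbinom A^-1 chi * mbinom A'^-1 lam * mval chi x * mval lam y *
    (mval (B * chi * (B' * lam)) (- 1) *
     \sum_u \sum_v mval (B * chi) u * mval (B' * lam) v *
                   mval (C * B^-1 * B'^-1) (1 - u - v)).
Proof.
have mval1M : mval 1 (x * y) = mval 1 x * mval 1 y.
  by rewrite mvalM // cfun1_lin_char.
transitivity (\sum_u \sum_v mval (B * B') (- 1) *
    mval (C * B^-1 * B'^-1) (1 - u - v) *
    (q1 * (mval 1 x * mval B u * mval A^-1 (1 - u * x))) *
    (q1 * (mval 1 y * mval B' v * mval A'^-1 (1 - v * y)))).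
  rewrite /appellF3 mval1M mulrA mulr_sumr; apply: eq_bigr => u _.
  by rewrite mulr_sumr; apply: eq_bigr => v _; ring.
transitivity (\sum_u \sum_v \sum_(chi <- mchars F) \sum_(lam <- mchars F)
    mbinom A^-1 chi * mbinom A'^-1 lam * mval chi x * mval lam y *
    (mval (B * chi * (B' * lam)) (- 1) *
     (mval (B * chi) u * mval (B' * lam) v *
      mval (C * B^-1 * B'^-1) (1 - u - v)))).
  apply: eq_bigr => u _; apply: eq_bigr => v _.
  rewrite !mbinom_expansion -mulrA mulr_suml mulr_sumr.
  apply: eq_bigr => chi _; rewrite !mulr_sumr.
  by apply: eq_bigr => lam _; rewrite !mval_mul; ring.
under eq_bigr do rewrite exchange_big; rewrite exchange_big /=.
apply: eq_bigr => chi _.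
under eq_bigr do rewrite exchange_big; rewrite exchange_big /=.
apply: eq_bigr => lam _; rewrite !mulr_sumr; apply: eq_bigr => u _.
by rewrite !mulr_sumr.
Qed.

End ExtendedCharacters.

Theorem theorem2p1 (F : finFieldType) (A A' B B' C : 'CF([set: {unit F}]))
  (hA : A \is a linear_char) (hA' : A' \is a linear_char)
  (hB : B \is a linear_char) (hB' : B' \is a linear_char)
  (hC : C \is a linear_char) (x y : F) :
  appellF3 A A' B B' C x y =
    1 / (#|F|%:R - 1) ^+ 2 *
      (\sum_(chi <- mchars F) \sum_(lam <- mchars F)
         mbinom A^-1 chi * mbinom A'^-1 lam *
         mbinom (C * B^-1 * B'^-1) (C * B'^-1 * chi) *
         mbinom (C * B'^-1 * chi) (C * chi * lam) *
         mval chi x * mval lam y)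
    + mval 1 y * mval B' (- 1) * mbinom A^-1 (B' * C^-1) *
      mval (B' * C^-1) x * mval A'^-1 (1 - y).
Proof.
set q1 : algC := #|F|%:R - 1.
have nz_q1 : q1 != 0.
  by rewrite /q1 -card_units pnatr_eq0 -lt0n cardG_gt0.
have nz_q1sq : q1 ^+ 2 != 0 by rewrite expf_neq0.
apply: (mulfI nz_q1sq).
rewrite appellF3_expansion mulrDr mulrA mul1r mulfV // mul1r.
set D := C * B^-1 * B'^-1.
have D_lin : D \is a linear_char by rewrite /D !(rpredM, rpredV).
have DB (chi : mclass F) : D * (B * chi) = C * B'^-1 * chi.
  by rewrite -[RHS]mul1r -(mulVr (lin_char_unitr hB)) /D; ring.
have DBB (chi lam : mclass F) : D * (B * chi) * (B' * lam) = C * chi * lam.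
  by rewrite DB -[RHS]mul1r -(mulVr (lin_char_unitr hB')); ring.
(* The sign [lam(- 1)] of the correction is moved into [mval lam (- y)], so that
   the sum over [lam] is a binomial expansion again. *)
transitivity (\sum_(chi <- mchars F) \sum_(lam <- mchars F)
   (mbinom A^-1 chi * mbinom A'^-1 lam *
         mbinom D (C * B'^-1 * chi) *
         mbinom (C * B'^-1 * chi) (C * chi * lam) *
         mval chi x * mval lam y +
    mbinom A^-1 chi * mval chi x * (mval B' (- 1) * (q1 *+ (chi == B' * C^-1)))
     * (mbinom A'^-1 lam * mval lam (- y)))).
  rewrite big_seq [RHS]big_seq; apply: eq_bigr => chi.
  rewrite mem_mchars => chi_lin.
  rewrite big_seq [RHS]big_seq; apply: eq_bigr => lam.
  rewrite mem_mchars => lam_lin.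
  have -> : (chi == B' * C^-1) = (D * (B * chi) == 1).
    rewrite DB [_ * chi]mulrC mul_mchar_eq1 ?rpredM ?rpredV //.
    by rewrite invrM ?rpredV ?lin_char_unitr // invrK.
  rewrite (double_jacobi_sum_mbinom (rpredM hB chi_lin) (rpredM hB' lam_lin)) //.
  by rewrite DBB DB -/q1 [mval lam (- y)]mvalN // mval_mul; ring.
under eq_bigr do rewrite big_split -mulr_sumr mbinom_theorem /=.
rewrite big_split; congr (_ + _) => /=.
have BC_in : B' * C^-1 \in mchars F by rewrite mem_mchars rpredM ?rpredV.
rewrite (bigD1_seq _ BC_in (mchars_uniq F)) /= eqxx mulr1n big1.
  by rewrite addr0 !mval_triv oppr_eq0 -/q1; ring.
by move=> chi /negPf->; rewrite mulr0n !(mulr0, mul0r).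
Qed.
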